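(* Let $F:[0,\infty)\to[0,\infty)$, $F\in C^1([0,\infty))\cap C^2((0,\infty))$, be a strictly convex function such that $F(0)=F'(0)=0$. Set $\Lambda(s)=s\,F''(s)/F'(s)$ for $s>0$ and assume that, for some constants $0<\Lambda^-\le\Lambda^+$, it holds that $\Lambda^-\le\Lambda(s)\le\Lambda^+$ for all $s>0$. Denote by $G:[0,\infty)\to[0,\infty)$ the Young conjugate of $F$. Let $\Omega\subseteq\mathbb{C}$ be an open set, suppose that $g:\Omega\to\mathbb{C}$ is differentiable in $\Omega$ and, for $z\in\Omega$ and $r>0$ with $\overline{D_r(z)}\subset\Omega$, let $c^{\mathcal J}(g,r)(z)$ be the minimum point in $\mathbb{C}$ of the function $$\mathcal{J}(c)=\int_{\partial D_r(z)} F\left(\left|\frac{G'(|g(\zeta)|)}{|g(\zeta)|}\,g(\zeta)-c\,\overline{(\zeta-z)}\right|\right) dS_\zeta,\quad c\in\mathbb{C}.$$ Then, away from the zeroes of $g$, $g$ is holomorphic in $\Omega$ if and only if $c^{\mathcal J}(g,r)(z)=o(1)$ as $r\to0^+$. That is: $g$ is holomorphic in $\{z\in\Omega: g(z)\neq0\}$ if and only if $\lim_{r\to0^+}c^{\mathcal J}(g,r)(z)=0$ for every $z\in\Omega$ with $g(z)\ne0$.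
   Context: $D_r(z)$ is the disk in $\mathbb{C}$ centered at $z$ with radius $r$; $dS_\zeta$ is the arc-length element. Differentiability is meant in the real sense (as a map from an open subset of $\mathbb{R}^2$ to $\mathbb{R}^2$). The Young (Fenchel) conjugate of $F$ is $G(t)=\sup\{ts-F(s): s\ge0\}$ for $t\ge0$; its derivative $G'$ is the inverse function of $F'$. The quantity $\frac{G'(|g|)}{|g|}g$ is understood to be $0$ where $g=0$. Under the stated assumptions $\mathcal J$ has exactly one minimum point. *)

(* Defs.v *)
From Stdlib Require Import Reals ClassicalEpsilon.
From Coquelicot Require Import Coquelicot.
Open Scope R_scope.

(* A function on [0, oo) is a total function on R of which only the values at
   nonnegative arguments are ever used: [Derive F s] is only meant for s > 0, and
   the derivative at 0 is the right derivative. *)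

Definition is_right_derive (F : R -> R) (x l : R) : Prop :=
  filterlim (fun h => (F (x + h) - F x) / h) (at_right 0) (locally l).

Definition C1_nonneg (F : R -> R) : Prop :=
  (forall s, 0 < s -> ex_derive F s /\ continuous (Derive F) s) /\
  exists l, is_right_derive F 0 l /\ filterlim (Derive F) (at_right 0) (locally l).

Definition C2_pos (F : R -> R) : Prop :=
  forall s, 0 < s ->
    ex_derive F s /\ ex_derive (Derive F) s /\ continuous (Derive (Derive F)) s.

Definition strictly_convex_nonneg (F : R -> R) : Prop :=
  forall x y t, 0 <= x -> 0 <= y -> x <> y -> 0 < t < 1 ->
    F (t * x + (1 - t) * y) < t * F x + (1 - t) * F y.

Definition Lambda (F : R -> R) (s : R) : R :=
  s * Derive (Derive F) s / Derive F s.

(* The supremum is taken in the extended reals and then sent to R, so this is the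
   Young conjugate wherever that is finite. *)
Definition young (F : R -> R) (t : R) : R :=
  real (Lub_Rbar (fun y => exists s, 0 <= s /\ y = t * s - F s)).

(* The value at w = 0 is 0, whatever the totalized [Derive] and division give. *)
Definition young_field (F : R -> R) (w : C) : C :=
  (RtoC (Derive (young F) (Cmod w) / Cmod w) * w)%C.

Definition circle_point (z : C) (r theta : R) : C :=
  (z + RtoC r * (cos theta, sin theta))%C.

(* Integral over the boundary of D_r(z), r > 0, with respect to arc length
   dS = r dtheta. *)
Definition circle_integral (z : C) (r : R) (f : C -> R) : R :=
  RInt (fun theta => f (circle_point z r theta) * r) 0 (2 * PI).

Definition J (F : R -> R) (g : C -> C) (r : R) (z : C) (c : C) : R :=
  circle_integral z r (fun zeta =>
    F (Cmod (young_field F (g zeta) - c * Cconj (zeta - z)))).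

Definition is_min_point (f : C -> R) (c : C) : Prop :=
  forall c' : C, f c <= f c'.

(* Meant for r > 0 with the closed disk of radius r at z inside the domain of g, where the minimum point
   of J exists and is unique. *)
Definition cJ (F : R -> R) (g : C -> C) (r : R) (z : C) : C :=
  epsilon (inhabits (RtoC 0)) (is_min_point (J F g r z)).

Definition real_differentiable (g : C -> C) (z : C) : Prop :=
  ex_filterdiff (K := R_AbsRing) (U := C_R_NormedModule) (V := C_R_NormedModule)
    g (locally z).

Definition holomorphic_on (U : C -> Prop) (g : C -> C) : Prop :=
  forall z, U z -> ex_derive (K := C_AbsRing) (V := C_NormedModule) g z.

(* Main.v *)
Require Import Defs.
From Stdlib Require Import Reals ClassicalEpsilon Lra.
From Coquelicot Require Import Coquelicot.
Open Scope R_scope.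

(** Write [f = F'], [V(w) = G'(|w|)/|w| w] and [A(w) = f(|w|)/|w| w]. Since [G'] is
    the inverse of [f], [A] inverts [V]; moreover [A] is the gradient of the convex
    function [w => F |w|], and it is C^1 away from 0.

    Both sides of the equivalence are pointwise. At a point [z] with [g z <> 0], put
    [w0 = V (g z)] and let [k > 0] be half the trace of the differential [DA(w0)]. Then
    the minimum points of [J] converge to [cs = (dbar g)(z) / k] ([cJ_limit]), so they
    tend to 0 exactly when the Cauchy-Riemann equation holds at [z].

    For the convergence, let [ebar] stand for the conjugate of [e^(i theta)], and let
    [u] be the values of [V o g] on the circle of radius [r]. For bounded [c'], strict
    differentiability of [A] at [w0] and real differentiability of [g] at [z] give
      [A (u - c' r ebar) = g z + r (linear part of g) - DA(w0) [c' r ebar] + o(r)];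
    paired with [e ebar], where [|e| = 1], the mean over the circle is
    [r <dbar g - k c', e> + o(r)] ([is_RInt_linearization]). If [c = cs + rho e] with
    [rho > delta], take [c' = cs + delta e]: the mean is then at most a negative multiple
    of [r], and the gradient inequality for [F |w|] at [u - c' r ebar], integrated over
    the circle, yields [J c' < J c] ([energy_gap]). So for small [r] every point outside
    the disk of radius [delta] about [cs] is beaten by a point of that disk. This gives
    both the existence of a global minimum point, because [J] is locally Lipschitz and
    attains its minimum on a square containing the disk, and the fact that every minimum
    point lies in the disk. Neither uniqueness of the minimum point nor
    differentiability of [J] is needed. *)

(** * The one-variable function F *)

(** What the argument uses of [F]: [F'] and [F''] are positive and [F''] is continuous
    on the positive half-line, [F'] takes every positive value there, and [F] is minimal
    at 0 and lies above its tangents. Continuity at the endpoint 0 is expressed through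
    the even extension. *)
Record convex_profile (F : R -> R) : Prop := {
  profile_derive2 : forall s, 0 < s ->
    is_derive (Derive F) s (Derive (Derive F) s);
  profile_continuous2 : forall s, 0 < s -> continuous (Derive (Derive F)) s;
  profile_pos : forall s, 0 < s -> 0 < Derive F s;
  profile_pos2 : forall s, 0 < s -> 0 < Derive (Derive F) s;
  profile_min : forall t, 0 <= t -> F 0 <= F t;
  profile_tangent : forall t t', 0 < t -> 0 <= t' ->
    F t + Derive F t * (t' - t) <= F t';
  profile_surj : forall t, 0 < t -> exists s, 0 < s /\ Derive F s = t;
  profile_continuous_abs : forall s, continuous (fun x => F (Rabs x)) s
}.

Lemma right_derive_unique (F : R -> R) (x a b : R) :
  is_right_derive F x a -> is_right_derive F x b -> a = b.
Proof.
intros Ha Hb.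
exact (filterlim_locally_unique _ _ _ Ha Hb).
Qed.

Lemma at_right_0_ex (P : R -> Prop) :
  at_right 0 P -> exists d, 0 < d /\ forall h, 0 < h < d -> P h.
Proof.
intros [d Hd]; exists d; split; [apply cond_pos|].
intros h [H1 H2]; apply Hd; auto.
change (Rabs (h - 0) < d); rewrite Rabs_pos_eq; lra.
Qed.

(** The derivative of the even extension of [F] at nonnegative arguments, when
    [F'(0) = 0]. *)
Definition right_slope (F : R -> R) (s : R) : R :=
  if Rlt_dec 0 s then Derive F s else 0.

Lemma right_slope_pos (F : R -> R) (s : R) :
  0 < s -> right_slope F s = Derive F s.
Proof. intros Hs; unfold right_slope; destruct (Rlt_dec 0 s); lra. Qed.

Lemma is_derive_abs_extension (F : R -> R) :
  (forall s, 0 < s -> ex_derive F s) -> F 0 = 0 -> is_right_derive F 0 0 ->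
  forall s, 0 <= s -> is_derive (fun x => F (Rabs x)) s (right_slope F s).
Proof.
intros HF F0 HF0 s Hs; unfold right_slope; destruct (Rlt_dec 0 s) as [H|H].
- apply is_derive_ext_loc with F.
  + exists (mkposreal s H); intros y Hy.
    change (Rabs (y - s) < s) in Hy.
    apply Rabs_def2 in Hy; rewrite Rabs_pos_eq; [reflexivity|lra].
  + apply Derive_correct; auto.
- replace s with 0 by lra.
  apply is_derive_Reals; intros eps Heps.
  destruct (at_right_0_ex _ (HF0 _ (locally_ball 0 (mkposreal eps Heps)))) as [d [Hd Hb]].
  exists (mkposreal d Hd); intros h Hh Hhd; simpl in Hhd.
  rewrite Rplus_0_l, Rabs_R0, F0.
  assert (Hp : 0 < Rabs h) by now apply Rabs_pos_lt.
  specialize (Hb (Rabs h) (conj Hp Hhd)).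
  change (Rabs ((F (0 + Rabs h) - F 0) / Rabs h - 0) < eps) in Hb.
  rewrite Rplus_0_l, F0, !Rminus_0_r in *.
  unfold Rdiv in *; rewrite Rabs_mult, Rabs_inv in *.
  now rewrite Rabs_Rabsolu in Hb.
Qed.

Lemma Rmean_value_abs_extension (F : R -> R) :
  (forall s, 0 < s -> ex_derive F s) -> F 0 = 0 -> is_right_derive F 0 0 ->
  forall a b, 0 <= a < b ->
  exists c, F b - F a = Derive F c * (b - a) /\ a < c < b.
Proof.
intros HF F0 HF0 a b Hab.
destruct (MVT_cor2 (fun x => F (Rabs x)) (right_slope F) a b) as [c [Hc Hc']].
- lra.
- intros c Hc; apply is_derive_Reals, is_derive_abs_extension; auto; lra.
- exists c; split; [|lra].
  rewrite right_slope_pos in Hc by lra.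
  rewrite !Rabs_pos_eq in Hc by lra; exact Hc.
Qed.

Lemma continuous_pt_of_derive (f : R -> R) (x l : R) :
  is_derive f x l -> continuity_pt f x.
Proof.
intros H; apply continuity_pt_filterlim.
apply (@ex_derive_continuous R_AbsRing R_NormedModule); exists l; exact H.
Qed.

Lemma continuous_abs_reflect (f : R -> R) (x : R) :
  continuous (fun y => f (Rabs y)) (Rabs x) -> continuous (fun y => f (Rabs y)) x.
Proof.
intros H.
apply (continuous_ext (fun y => f (Rabs (Rabs y)))).
- intros y; now rewrite Rabs_Rabsolu.
- apply (continuous_comp Rabs (fun y => f (Rabs y))); auto.
  apply continuous_Rabs.
Qed.

(** The lower bound on [Lambda] makes [F''] positive, and it makes [F'] grow at least
    logarithmically, so that [F'] is onto. *)
Lemma convex_profile_of_Lambda_bound (F : R -> R) (Lm : R) :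
  (forall s, 0 <= s -> 0 <= F s) -> C1_nonneg F -> C2_pos F ->
  F 0 = 0 -> is_right_derive F 0 0 ->
  0 < Lm -> (forall s, 0 < s -> Lm <= Lambda F s) ->
  convex_profile F.
Proof.
intros Fnn [_ [l [Hl Hf0]]] C2 F0 HF0 HLm HL.
rewrite (right_derive_unique _ _ _ _ Hl HF0) in Hf0; clear l Hl.
assert (HF : forall s, 0 < s -> ex_derive F s) by (intros s Hs; apply C2; auto).
assert (D2 : forall s, 0 < s -> is_derive (Derive F) s (Derive (Derive F) s))
  by (intros s Hs; apply Derive_correct; apply C2; auto).
assert (Cf : forall s, 0 < s -> continuity_pt (Derive F) s)
  by (intros s Hs; eapply continuous_pt_of_derive, D2; auto).
assert (MV := Rmean_value_abs_extension F HF F0 HF0).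
(* Division by zero gives zero, so [F' s = 0] would make [Lambda F s] vanish. *)
assert (Hne : forall s, 0 < s -> Derive F s <> 0).
{ intros s Hs H; specialize (HL s Hs); unfold Lambda in HL.
  rewrite H in HL; unfold Rdiv in HL; rewrite Rinv_0 in HL; lra. }
assert (Hpos : forall s, 0 < s -> 0 < Derive F s).
{ intros s Hs; destruct (Rlt_le_dec 0 (Derive F s)) as [H|H]; auto.
  assert (Hs' : Derive F s < 0) by (specialize (Hne s Hs); lra).
  destruct (MV 0 s) as [c [Hc Hc']]; [lra|].
  assert (Hc0 : 0 < Derive F c).
  { assert (0 <= Derive F c * (s - 0)) by (rewrite <- Hc, F0; specialize (Fnn s); lra).
    specialize (Hne c ltac:(lra)); nra. }
  destruct (Ranalysis5.IVT_interv (fun x => - Derive F x) c s) as [z [Hz Hz']]; try lra.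
  - intros a Ha; apply continuity_pt_opp, Cf; lra.
  - exfalso; apply (Hne z); lra. }
assert (Hquot : forall s, 0 < s -> Lm * (Derive F s / s) <= Derive (Derive F) s).
{ intros s Hs; specialize (HL s Hs); unfold Lambda in HL; specialize (Hpos s Hs).
  replace (Derive (Derive F) s)
    with (s * Derive (Derive F) s / Derive F s * (Derive F s / s)) by (field; lra).
  apply Rmult_le_compat_r; auto.
  apply Rlt_le, Rdiv_lt_0_compat; lra. }
assert (Hpos2 : forall s, 0 < s -> 0 < Derive (Derive F) s).
{ intros s Hs; eapply Rlt_le_trans; [|now apply Hquot].
  apply Rmult_lt_0_compat; auto; apply Rdiv_lt_0_compat; auto. }
assert (Hincr : forall a b, 0 < a < b -> Derive F a < Derive F b).
{ intros a b Hab.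
  destruct (MVT_cor2 (Derive F) (Derive (Derive F)) a b) as [c [Hc Hc']]; [lra| |].
  - intros c Hc; apply is_derive_Reals, D2; lra.
  - specialize (Hpos2 c ltac:(lra)); nra. }
split; auto.
- intros s Hs; apply C2; auto.
- intros t Ht; rewrite F0; auto.
- intros t t' Ht Ht'.
  destruct (Rtotal_order t t') as [H|[H|H]].
  + destruct (MV t t') as [c [Hc Hc']]; [lra|].
    specialize (Hincr t c ltac:(lra)); nra.
  + subst; lra.
  + destruct (MV t' t) as [c [Hc Hc']]; [lra|].
    specialize (Hincr c t ltac:(lra)); nra.
- intros t Ht.
  destruct (at_right_0_ex _ (Hf0 _ (locally_ball 0 (mkposreal t Ht)))) as [d [Hd Hb]].
  set (a := Rmin (d / 2) 1).
  assert (Ha : 0 < a <= 1) by (split; [apply Rmin_glb_lt; lra|apply Rmin_r]).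
  assert (Ha' : Derive F a < t).
  { assert (a < d) by (apply Rle_lt_trans with (d / 2); [apply Rmin_l|lra]).
    specialize (Hb a ltac:(lra)).
    change (Rabs (Derive F a - 0) < t) in Hb; apply Rabs_def2 in Hb; lra. }
  (* [F' - m ln] is nondecreasing on [1, oo), hence [F'] is unbounded. *)
  set (m := Lm * Derive F 1).
  assert (Hm : 0 < m) by (apply Rmult_lt_0_compat; auto; apply Hpos; lra).
  set (b := exp (t / m)).
  assert (Hb1 : 1 < b).
  { unfold b; rewrite <- exp_0; apply exp_increasing, Rdiv_lt_0_compat; auto. }
  assert (Hb' : t < Derive F b).
  { destruct (MVT_cor2 (fun x => Derive F x - m * ln x)
      (fun x => Derive (Derive F) x - m * / x) 1 b) as [c [Hc Hc']]; auto.
    - intros c Hc; apply is_derive_Reals.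
      apply (is_derive_minus (K := R_AbsRing) (V := R_NormedModule)); [apply D2; lra|].
      apply is_derive_scal; apply is_derive_Reals, derivable_pt_lim_ln; lra.
    - rewrite ln_1 in Hc; unfold b in Hc at 2; rewrite ln_exp in Hc.
      assert (Hge : 0 <= Derive (Derive F) c - m * / c).
      { specialize (Hquot c ltac:(lra)); specialize (Hincr 1 c ltac:(lra)).
        assert (m * / c <= Lm * (Derive F c / c)); [|lra].
        unfold m, Rdiv; rewrite Rmult_assoc.
        apply Rmult_le_compat_l; [lra|]; apply Rmult_le_compat_r; [|lra].
        apply Rlt_le, Rinv_0_lt_compat; lra. }
      assert (m * (t / m) = t) by (field; lra).
      specialize (Hpos 1 ltac:(lra)); nra. }
  destruct (Ranalysis5.IVT_interv (fun x => Derive F x - t) a b) as [z [Hz Hz']]; try lra.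
  + intros x Hx; apply continuity_pt_minus; [apply Cf; lra|].
    apply continuity_pt_const; now intros ? ?.
  + exists z; split; lra.
- intros s; apply continuous_abs_reflect.
  apply (@ex_derive_continuous R_AbsRing R_NormedModule).
  eexists; apply is_derive_abs_extension; auto; apply Rabs_pos.
Qed.

(** * The Young conjugate *)

Lemma profile_increasing (F : R -> R) :
  convex_profile F -> forall a b, 0 < a < b -> Derive F a < Derive F b.
Proof.
intros HF a b Hab.
destruct (MVT_cor2 (Derive F) (Derive (Derive F)) a b) as [c [Hc Hc']]; [lra| |].
- intros c Hc; apply is_derive_Reals, profile_derive2; auto; lra.
- assert (H := profile_pos2 F HF c ltac:(lra)); nra.
Qed.

(** The inverse of [F'] on the positive half-line. *)
Definition slope_inverse (F : R -> R) (t : R) : R :=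
  epsilon (inhabits 0) (fun s => 0 < s /\ Derive F s = t).

Lemma slope_inverse_spec (F : R -> R) : convex_profile F ->
  forall t, 0 < t -> 0 < slope_inverse F t /\ Derive F (slope_inverse F t) = t.
Proof.
intros HF t Ht; unfold slope_inverse; apply epsilon_spec, profile_surj; auto.
Qed.

Lemma slope_inverse_continuous (F : R -> R) : convex_profile F ->
  forall t, 0 < t -> continuous (slope_inverse F) t.
Proof.
intros HF t Ht.
destruct (slope_inverse_spec F HF t Ht) as [Hs Hst]; set (s := slope_inverse F t) in *.
assert (Hi := profile_increasing F HF).
apply filterlim_locally; intros [eps Heps].
set (e := Rmin eps (s / 2)).
assert (He : 0 < e <= eps) by (split; [apply Rmin_glb_lt; lra|apply Rmin_l]).
assert (He' : e <= s / 2) by apply Rmin_r.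
assert (H1 := Hi (s - e) s ltac:(lra)); assert (H2 := Hi s (s + e) ltac:(lra)).
assert (H0 := profile_pos F HF (s - e) ltac:(lra)).
assert (Hd : 0 < Rmin (t - Derive F (s - e)) (Derive F (s + e) - t))
  by (apply Rmin_glb_lt; lra).
exists (mkposreal _ Hd); intros t' Ht'.
change (Rabs (t' - t) < Rmin (t - Derive F (s - e)) (Derive F (s + e) - t)) in Ht'.
assert (Ha := Rlt_le_trans _ _ _ Ht' (Rmin_l _ _)).
assert (Hb := Rlt_le_trans _ _ _ Ht' (Rmin_r _ _)).
apply Rabs_def2 in Ha; apply Rabs_def2 in Hb.
destruct (slope_inverse_spec F HF t' ltac:(lra)) as [Hs' Hst'].
change (Rabs (slope_inverse F t' - s) < eps).
set (s' := slope_inverse F t') in *.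
assert (s - e < s').
{ destruct (Rlt_le_dec (s - e) s') as [H|[H|H]]; auto.
  - specialize (Hi s' (s - e) ltac:(lra)); lra.
  - rewrite H in Hst'; lra. }
assert (s' < s + e).
{ destruct (Rlt_le_dec s' (s + e)) as [H'|[H'|H']]; auto.
  - specialize (Hi (s + e) s' ltac:(lra)); lra.
  - rewrite <- H' in Hst'; lra. }
apply Rabs_def1; lra.
Qed.

(** The supremum defining the conjugate is attained at the point of slope [t]. *)
Lemma young_eq (F : R -> R) : convex_profile F -> forall t, 0 < t ->
  young F t = t * slope_inverse F t - F (slope_inverse F t).
Proof.
intros HF t Ht; unfold young.
destruct (slope_inverse_spec F HF t Ht) as [Hs Hst]; set (s := slope_inverse F t) in *.
rewrite (is_lub_Rbar_unique _ (Finite (t * s - F s))); [reflexivity|].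
split.
- intros y [x [Hx ->]]; simpl.
  assert (H := profile_tangent F HF s x Hs Hx); rewrite Hst in H; lra.
- intros b Hb; apply Hb; exists s; split; [lra|reflexivity].
Qed.

Lemma young_tangent (F : R -> R) : convex_profile F -> forall t t', 0 < t -> 0 < t' ->
  young F t + slope_inverse F t * (t' - t) <= young F t'.
Proof.
intros HF t t' Ht Ht'; rewrite !young_eq by auto.
destruct (slope_inverse_spec F HF t Ht) as [Hs Hst].
destruct (slope_inverse_spec F HF t' Ht') as [Hs' Hst'].
assert (H := profile_tangent F HF _ (slope_inverse F t) Hs' ltac:(lra)).
rewrite Hst' in H; lra.
Qed.

(** [G' = (F')^-1]: the two tangent inequalities at [t] and at [t + h] enclose the
    difference quotient between values of the continuous inverse. *)
Lemma Derive_young (F : R -> R) : convex_profile F -> forall t, 0 < t ->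
  Derive (young F) t = slope_inverse F t.
Proof.
intros HF t Ht; apply is_derive_unique, is_derive_Reals; intros eps Heps.
assert (Hc := slope_inverse_continuous F HF t Ht).
apply filterlim_locally with (eps := mkposreal eps Heps) in Hc.
destruct Hc as [[d Hd] Hc].
assert (Hd' : 0 < Rmin d t) by (apply Rmin_glb_lt; lra).
exists (mkposreal _ Hd'); intros h Hh Hhd; simpl in Hhd.
assert (Ha := Rlt_le_trans _ _ _ Hhd (Rmin_l _ _)).
assert (Hb := Rlt_le_trans _ _ _ Hhd (Rmin_r _ _)).
apply Rabs_def2 in Hb.
specialize (Hc (t + h)).
assert (Hball : Rabs (slope_inverse F (t + h) - slope_inverse F t) < eps).
{ apply Hc; change (Rabs (t + h - t) < d); now replace (t + h - t) with h by ring. }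
apply Rabs_def2 in Hball.
assert (H1 := young_tangent F HF t (t + h) Ht ltac:(lra)).
assert (H2 := young_tangent F HF (t + h) t ltac:(lra) Ht).
set (u := slope_inverse F (t + h)) in *; set (v := slope_inverse F t) in *.
set (D := young F (t + h) - young F t).
assert (Hq : D / h * h = D) by (field; auto).
assert (HD : D = young F (t + h) - young F t) by reflexivity.
destruct (Rtotal_order h 0) as [Hn|[Hz|Hp]]; [|lra|];
  apply Rabs_def1; nra.
Qed.

(** * The fields A and V *)

(** The real inner product of the plane. *)
Definition dot (a b : C) : R := fst a * fst b + snd a * snd b.

Lemma Cmod_sqr (w : C) : Cmod w * Cmod w = dot w w.
Proof.
unfold Cmod, dot; rewrite sqrt_sqrt; [ring|].
apply Rplus_le_le_0_compat; apply pow2_ge_0.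
Qed.

Lemma dot_le_Cmod (a b : C) : dot a b <= Cmod a * Cmod b.
Proof.
destruct (Rle_lt_dec (dot a b) 0) as [H|H].
- apply Rle_trans with 0; auto; apply Rmult_le_pos; apply Cmod_ge_0.
- apply Rsqr_incr_0_var; [|apply Rmult_le_pos; apply Cmod_ge_0].
  unfold Rsqr.
  replace (Cmod a * Cmod b * (Cmod a * Cmod b))
    with ((Cmod a * Cmod a) * (Cmod b * Cmod b)) by ring.
  rewrite !Cmod_sqr; unfold dot.
  assert (H0 := Rle_0_sqr (fst a * snd b - snd a * fst b)); unfold Rsqr in H0; nra.
Qed.

(** The gradient of [w => F |w|]: the field [F'(|w|)/|w| w]. *)
Definition slope_field (F : R -> R) (w : C) : C :=
  (RtoC (Derive F (Cmod w) / Cmod w) * w)%C.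

Lemma dot_scal_l (k : R) (a b : C) : dot (RtoC k * a) b = k * dot a b.
Proof. unfold dot; simpl; ring. Qed.

(** The tangent inequality for the convex function [w => F |w|]. *)
Lemma slope_field_gradient (F : R -> R) : convex_profile F ->
  forall w w' : C, w <> RtoC 0 ->
  F (Cmod w) + dot (slope_field F w) (w' - w) <= F (Cmod w').
Proof.
intros HF w w' Hw.
assert (Hp := proj1 (Cmod_gt_0 w) Hw).
eapply Rle_trans; [|apply (profile_tangent F HF (Cmod w) (Cmod w')); auto using Cmod_ge_0].
apply Rplus_le_compat_l; unfold slope_field; rewrite dot_scal_l.
unfold Rdiv; rewrite Rmult_assoc; apply Rmult_le_compat_l.
{ apply Rlt_le, profile_pos; auto. }
apply Rmult_le_reg_l with (Cmod w); auto.
rewrite <- Rmult_assoc, Rinv_r, Rmult_1_l by lra.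
rewrite Rmult_minus_distr_l, Cmod_sqr.
replace (dot w (w' - w)) with (dot w w' - dot w w) by (unfold dot; simpl; ring).
apply Rplus_le_compat_r, dot_le_Cmod.
Qed.

Lemma Cmod_young_field (F : R -> R) : convex_profile F ->
  forall w, w <> RtoC 0 -> Cmod (young_field F w) = slope_inverse F (Cmod w).
Proof.
intros HF w Hw; assert (Hp := proj1 (Cmod_gt_0 w) Hw).
destruct (slope_inverse_spec F HF _ Hp) as [Hs _].
unfold young_field; rewrite Cmod_mult, Cmod_R, Derive_young by auto.
rewrite Rabs_pos_eq; [field; lra|].
apply Rlt_le, Rdiv_lt_0_compat; auto.
Qed.

Lemma young_field_neq_0 (F : R -> R) : convex_profile F ->
  forall w, w <> RtoC 0 -> young_field F w <> RtoC 0.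
Proof.
intros HF w Hw; apply Cmod_gt_0; rewrite Cmod_young_field by auto.
apply slope_inverse_spec; auto; now apply Cmod_gt_0.
Qed.

(** [A] is a left inverse of [V] away from 0. *)
Lemma slope_field_young_field (F : R -> R) : convex_profile F ->
  forall w, w <> RtoC 0 -> slope_field F (young_field F w) = w.
Proof.
intros HF w Hw; assert (Hp := proj1 (Cmod_gt_0 w) Hw).
destruct (slope_inverse_spec F HF _ Hp) as [Hs Hst].
unfold slope_field; rewrite Cmod_young_field, Hst by auto.
unfold young_field; rewrite Derive_young by auto.
rewrite Cmult_assoc, <- RtoC_mult.
replace (_ * _)%R with 1 by (field; lra); ring.
Qed.

Lemma continuous_Cpair {T : UniformSpace} (p q : T -> R) (x : T) :
  continuous p x -> continuous q x ->
  continuous (U := C_UniformSpace) (fun y => (p y, q y) : C) x.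
Proof.
intros Hp Hq; apply (continuous_comp_2 p q (fun a b => (a, b))); auto.
apply (continuous_ext (T := prod_UniformSpace R_UniformSpace R_UniformSpace)
  (U := prod_UniformSpace R_UniformSpace R_UniformSpace) (fun y => y)).
- now intros [? ?].
- apply continuous_id.
Qed.

Lemma continuous_Cfst {T : UniformSpace} (p : T -> C) (x : T) :
  continuous (U := C_UniformSpace) p x -> continuous (fun y => fst (p y)) x.
Proof.
intros Hp; apply (continuous_comp (V := C_UniformSpace) p fst); auto.
destruct (p x); apply continuous_fst.
Qed.

Lemma continuous_Csnd {T : UniformSpace} (p : T -> C) (x : T) :
  continuous (U := C_UniformSpace) p x -> continuous (fun y => snd (p y)) x.
Proof.
intros Hp; apply (continuous_comp (V := C_UniformSpace) p snd); auto.
destruct (p x); apply continuous_snd.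
Qed.

Lemma continuous_Cmod_comp {T : UniformSpace} (p : T -> C) (x : T) :
  continuous (U := C_UniformSpace) p x -> continuous (fun y => Cmod (p y)) x.
Proof.
intros Hp.
apply (continuous_ext (fun y => sqrt (fst (p y) * fst (p y) + snd (p y) * snd (p y)))).
- intros y; unfold Cmod; f_equal; ring.
- assert (H1 := continuous_Cfst p x Hp); assert (H2 := continuous_Csnd p x Hp).
  apply (continuous_comp _ sqrt); [|apply continuous_sqrt].
  apply (continuous_plus (V := R_NormedModule)).
  + exact (continuous_mult (K := R_AbsRing) _ _ x H1 H1).
  + exact (continuous_mult (K := R_AbsRing) _ _ x H2 H2).
Qed.

Lemma locally_C_ex (z : C) (P : C -> Prop) :
  locally (T := C_UniformSpace) z P ->
  exists d, 0 < d /\ forall y, Cmod (y - z) < d -> P y.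
Proof.
intros H; apply locally_C in H; destruct H as [d Hd].
exists d; split; [apply cond_pos|exact Hd].
Qed.

Lemma locally_C_of_Cmod (z : C) (P : C -> Prop) (d : R) : 0 < d ->
  (forall y, Cmod (y - z) < d -> P y) -> locally (T := C_UniformSpace) z P.
Proof. intros Hd H; apply locally_C; exists (mkposreal d Hd); exact H. Qed.

Lemma continuous_C_ex (p : C -> C) (z : C) :
  continuous (T := C_UniformSpace) (U := C_UniformSpace) p z ->
  forall eps, 0 < eps ->
  exists d, 0 < d /\ forall y, Cmod (y - z) < d -> Cmod (p y - p z) < eps.
Proof.
intros Hp eps He; apply (locally_C_ex z (fun y => Cmod (p y - p z) < eps)).
apply (Hp (fun y => Cmod (y - p z) < eps)).
apply (locally_C_of_Cmod _ _ eps); auto.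
Qed.

Lemma young_field_continuous (F : R -> R) : convex_profile F ->
  forall w, w <> RtoC 0 ->
  continuous (T := C_UniformSpace) (U := C_UniformSpace) (young_field F) w.
Proof.
intros HF w Hw; assert (Hp := proj1 (Cmod_gt_0 w) Hw).
set (h := fun y => slope_inverse F (Cmod y) / Cmod y).
assert (Cm : continuous (T := C_UniformSpace) Cmod w)
  by apply continuous_Cmod_comp, continuous_id.
apply (continuous_ext_loc (T := C_UniformSpace) (U := C_UniformSpace)
  (young_field F) (fun y : C => (h y * fst y, h y * snd y) : C) w).
- assert (Hl : locally (T := C_UniformSpace) w (fun y => 0 < Cmod y)).
  { apply (Cm (fun t => 0 < t)); now apply open_gt. }
  revert Hl; apply filter_imp; intros y Hy.
  unfold young_field, h; rewrite Derive_young by auto.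
  unfold Cmult; simpl; f_equal; ring.
- assert (Hh : continuous (T := C_UniformSpace) h w).
  { unfold h; apply (continuous_mult (K := R_AbsRing)).
    - apply (continuous_comp (U := C_UniformSpace) Cmod (slope_inverse F)); auto.
      now apply slope_inverse_continuous.
    - apply (continuous_comp (U := C_UniformSpace) Cmod Rinv); auto.
      apply continuous_Rinv; lra. }
  apply continuous_Cpair; apply (continuous_mult (K := R_AbsRing)); auto.
  + apply continuous_Cfst, continuous_id.
  + apply continuous_Csnd, continuous_id.
Qed.

(** * Strict differentiability of A *)

Lemma continuous_CR_ex (p : C -> R) (z : C) :
  continuous (T := C_UniformSpace) p z -> forall eps, 0 < eps ->
  exists d, 0 < d /\ forall y, Cmod (y - z) < d -> Rabs (p y - p z) < eps.
Proof.
intros Hp eps He; apply (locally_C_ex z (fun y => Rabs (p y - p z) < eps)).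
exact (Hp _ (locally_ball (p z) (mkposreal eps He))).
Qed.

(** The factor [F'(t)/t] of the gradient field. *)
Definition slope_ratio (F : R -> R) (t : R) : R := Derive F t / t.

(** With [q(t^2) = F'(t)/t], this is [2 q'(t^2)]: the coefficient of the part of the
    Hessian of [w => F |w|] that is not a multiple of the identity. *)
Definition slope_defect (F : R -> R) (t : R) : R :=
  (Derive (Derive F) t - slope_ratio F t) / (t * t).

(** The bilinear form [(v, d) |-> <DA(w) v, d>], with [DA(w)] the differential at [w]
    of the gradient field [A] of [w => F |w|], that is the Hessian form of the latter. *)
Definition slope_form (F : R -> R) (w v d : C) : R :=
  slope_ratio F (Cmod w) * dot v d + slope_defect F (Cmod w) * dot w v * dot w d.

Lemma is_derive_Cmod_line (u v : C) (t : R) : (u - RtoC t * v)%C <> RtoC 0 ->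
  is_derive (fun t => Cmod (u - RtoC t * v)) t
    (- (dot (u - RtoC t * v) v / Cmod (u - RtoC t * v))).
Proof.
intros Hne; apply Cmod_gt_0 in Hne.
assert (Hq : is_derive (fun t => dot (u - RtoC t * v) (u - RtoC t * v)) t
  (- 2 * dot (u - RtoC t * v) v)).
{ unfold dot; simpl; auto_derive; auto; ring. }
apply (is_derive_ext (fun t => sqrt (dot (u - RtoC t * v) (u - RtoC t * v)))).
- intros s; apply sqrt_lem_1; try apply Cmod_ge_0; [|apply Cmod_sqr].
  rewrite <- Cmod_sqr; apply Rmult_le_pos; apply Cmod_ge_0.
- assert (H0 := is_derive_sqrt _ _ _ Hq); cbv beta in H0; rewrite <- Cmod_sqr in H0.
  rewrite sqrt_square in H0 by lra.
  match goal with |- is_derive _ _ ?l => match type of H0 with _ -> is_derive _ _ ?l' =>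
    replace l with l' by (field; lra) end end.
  apply H0; now apply Rmult_lt_0_compat.
Qed.

Lemma is_derive_slope_field_line (F : R -> R) : convex_profile F ->
  forall (u v d : C) (t : R), (u - RtoC t * v)%C <> RtoC 0 ->
  is_derive (fun t => dot (slope_field F (u - RtoC t * v)) d) t
    (- slope_form F (u - RtoC t * v) v d).
Proof.
intros HF u v d t Hne.
assert (HN := is_derive_Cmod_line u v t Hne); apply Cmod_gt_0 in Hne.
set (N := Cmod (u - RtoC t * v)) in *.
assert (Hr : is_derive (slope_ratio F) N
  ((Derive (Derive F) N * N - Derive F N * 1) / N ^ 2)).
{ apply (is_derive_div (Derive F) (fun x => x)); [apply profile_derive2; auto| |lra].
  apply (is_derive_id (K := R_AbsRing)). }
assert (Hc := is_derive_comp (V := R_NormedModule) (slope_ratio F)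
  (fun t => Cmod (u - RtoC t * v)) t _ _ Hr HN).
assert (Hd : is_derive (fun t => dot (u - RtoC t * v) d) t (- dot v d)).
{ unfold dot; simpl; auto_derive; auto; ring. }
apply (is_derive_ext (fun t => slope_ratio F (Cmod (u - RtoC t * v)) *
  dot (u - RtoC t * v) d)).
- intros s; unfold slope_field; now rewrite dot_scal_l.
- assert (Hm := is_derive_mult _ _ t _ _ Hc Hd Rmult_comm).
  match type of Hm with is_derive _ _ ?l => replace (- slope_form F _ v d) with l end.
  + exact Hm.
  + unfold plus, mult, scal; simpl; unfold mult; simpl.
    unfold slope_form, slope_defect; fold N; unfold slope_ratio.
    field; lra.
Qed.

Lemma slope_form_entries (F : R -> R) (w v d : C) :
  slope_form F w v d =
    (slope_ratio F (Cmod w) + slope_defect F (Cmod w) * (fst w * fst w)) * (fst v * fst d)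
    + slope_defect F (Cmod w) * (fst w * snd w) * (fst v * snd d + snd v * fst d)
    + (slope_ratio F (Cmod w) + slope_defect F (Cmod w) * (snd w * snd w)) *
      (snd v * snd d).
Proof. unfold slope_form, dot; ring. Qed.

Lemma Rabs_fst_Cmod (v : C) : Rabs (fst v) <= Cmod v.
Proof. eapply Rle_trans; [|apply Rmax_Cmod]; apply Rmax_l. Qed.

Lemma Rabs_snd_Cmod (v : C) : Rabs (snd v) <= Cmod v.
Proof. eapply Rle_trans; [|apply Rmax_Cmod]; apply Rmax_r. Qed.

Lemma Rmult3_bound (m x y e a b : R) :
  Rabs m <= e -> Rabs x <= a -> Rabs y <= b -> m * (x * y) <= e * (a * b).
Proof.
intros Hm Hx Hy; eapply Rle_trans; [apply Rle_abs|]; rewrite !Rabs_mult.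
apply Rmult_le_compat; auto using Rabs_pos.
- apply Rmult_le_pos; apply Rabs_pos.
- apply Rmult_le_compat; auto using Rabs_pos.
Qed.

Lemma slope_form_continuous (F : R -> R) : convex_profile F ->
  forall w0, w0 <> RtoC 0 -> forall eps, 0 < eps ->
  exists eta, 0 < eta /\ forall w v d : C, Cmod (w - w0) < eta ->
    slope_form F w0 v d - slope_form F w v d <= eps * (Cmod v * Cmod d).
Proof.
intros HF w0 Hw0 eps Heps; assert (Hp := proj1 (Cmod_gt_0 w0) Hw0).
assert (Cm : continuous (T := C_UniformSpace) Cmod w0)
  by apply continuous_Cmod_comp, continuous_id.
assert (Ci : continuous Rinv (Cmod w0)) by (apply continuous_Rinv; lra).
assert (C1' : continuous (slope_ratio F) (Cmod w0)).
{ apply (continuous_mult (K := R_AbsRing)); auto.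
  apply (@ex_derive_continuous R_AbsRing R_NormedModule).
  eexists; apply profile_derive2; auto. }
assert (C2' : continuous (slope_defect F) (Cmod w0)).
{ apply (continuous_mult (K := R_AbsRing)).
  - apply (continuous_minus (V := R_NormedModule)); auto.
    now apply profile_continuous2.
  - apply (continuous_comp (fun t => t * t) Rinv).
    + apply (continuous_mult (K := R_AbsRing)); apply continuous_id.
    + apply continuous_Rinv; nra. }
assert (Cr := continuous_comp (U := C_UniformSpace) Cmod (slope_ratio F) w0 Cm C1').
assert (Cd := continuous_comp (U := C_UniformSpace) Cmod (slope_defect F) w0 Cm C2').
assert (Cx := continuous_Cfst (T := C_UniformSpace) (fun w => w) w0 (continuous_id w0)).
assert (Cy := continuous_Csnd (T := C_UniformSpace) (fun w => w) w0 (continuous_id w0)).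
assert (Hprod : forall p q : C -> R, continuous (T := C_UniformSpace) p w0 ->
  continuous (T := C_UniformSpace) q w0 ->
  continuous (T := C_UniformSpace) (fun w => p w * q w) w0).
{ intros p q P Q; exact (continuous_mult (K := R_AbsRing) p q w0 P Q). }
assert (Hplus : forall p q : C -> R, continuous (T := C_UniformSpace) p w0 ->
  continuous (T := C_UniformSpace) q w0 ->
  continuous (T := C_UniformSpace) (fun w => p w + q w) w0).
{ intros p q P Q; exact (continuous_plus (V := R_NormedModule) p q w0 P Q). }
assert (He4 : 0 < eps / 4) by lra.
destruct (continuous_CR_ex _ _ (Hplus _ _ Cr (Hprod _ _ Cd (Hprod _ _ Cx Cx))) _ He4)
  as [d1 [Hd1 H1]].
destruct (continuous_CR_ex _ _ (Hprod _ _ Cd (Hprod _ _ Cx Cy)) _ He4) as [d2 [Hd2 H2]].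
destruct (continuous_CR_ex _ _ (Hplus _ _ Cr (Hprod _ _ Cd (Hprod _ _ Cy Cy))) _ He4)
  as [d3 [Hd3 H3]].
exists (Rmin d1 (Rmin d2 d3)); split; [now repeat apply Rmin_glb_lt|].
intros w v d Hw.
specialize (H1 w (Rlt_le_trans _ _ _ Hw (Rmin_l _ _))).
assert (Hw' := Rlt_le_trans _ _ _ Hw (Rmin_r _ _)).
specialize (H2 w (Rlt_le_trans _ _ _ Hw' (Rmin_l _ _))).
specialize (H3 w (Rlt_le_trans _ _ _ Hw' (Rmin_r _ _))).
rewrite !slope_form_entries.
rewrite Rabs_minus_sym in H1, H2, H3; cbv beta in *.
apply Rlt_le in H1; apply Rlt_le in H2; apply Rlt_le in H3.
assert (V1 := Rabs_fst_Cmod v); assert (V2 := Rabs_snd_Cmod v).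
assert (D1 := Rabs_fst_Cmod d); assert (D2 := Rabs_snd_Cmod d).
assert (B1 := Rmult3_bound _ _ _ _ _ _ H1 V1 D1).
assert (B2 := Rmult3_bound _ _ _ _ _ _ H2 V1 D2).
assert (B3 := Rmult3_bound _ _ _ _ _ _ H2 V2 D1).
assert (B4 := Rmult3_bound _ _ _ _ _ _ H3 V2 D2).
lra.
Qed.

(** Strict differentiability of the gradient field at [w0 <> 0], tested against a
    direction [d]: the base point [u] varies along with the increment [v]. *)
Lemma slope_field_strict_derive (F : R -> R) : convex_profile F ->
  forall w0, w0 <> RtoC 0 -> forall eps, 0 < eps ->
  exists eta, 0 < eta /\ forall u v d : C, Cmod (u - w0) < eta -> Cmod v < eta ->
    (u - v)%C <> RtoC 0 /\
    dot (slope_field F (u - v)) d <=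
      dot (slope_field F u) d - slope_form F w0 v d + eps * (Cmod v * Cmod d).
Proof.
intros HF w0 Hw0 eps Heps; assert (Hp := proj1 (Cmod_gt_0 w0) Hw0).
destruct (slope_form_continuous F HF w0 Hw0 eps Heps) as [e [He Hform]].
exists (Rmin (e / 2) (Cmod w0 / 2)); split; [apply Rmin_glb_lt; lra|].
intros u v d Hu Hv.
assert (Hu1 := Rlt_le_trans _ _ _ Hu (Rmin_l _ _)).
assert (Hu2 := Rlt_le_trans _ _ _ Hu (Rmin_r _ _)).
assert (Hv1 := Rlt_le_trans _ _ _ Hv (Rmin_l _ _)).
assert (Hv2 := Rlt_le_trans _ _ _ Hv (Rmin_r _ _)).
assert (Hline : forall t, 0 <= t <= 1 ->
  Cmod (u - RtoC t * v - w0) < e /\ (u - RtoC t * v)%C <> RtoC 0).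
{ intros t Ht.
  assert (Htv : Cmod (RtoC t * v) <= Cmod v).
  { rewrite Cmod_mult, Cmod_R, Rabs_pos_eq by lra.
    assert (H := Cmod_ge_0 v); nra. }
  assert (Hd : Cmod (u - RtoC t * v - w0) <= Cmod (u - w0) + Cmod (RtoC t * v)).
  { replace (u - RtoC t * v - w0)%C with ((u - w0) + - (RtoC t * v))%C by ring.
    eapply Rle_trans; [apply Cmod_triangle|]; rewrite Cmod_opp; lra. }
  split; [lra|]; intros H.
  assert (Hx : Cmod (u - RtoC t * v - w0) < Cmod w0) by lra.
  rewrite H in Hx; replace (0 - w0)%C with (- w0)%C in Hx by ring.
  rewrite Cmod_opp in Hx; lra. }
assert (E1 : (u - RtoC 1 * v = u - v)%C) by ring.
assert (E0 : (u - RtoC 0 * v = u)%C) by ring.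
split; [rewrite <- E1; apply Hline; lra|].
destruct (MVT_cor2 (fun t => dot (slope_field F (u - RtoC t * v)) d)
  (fun t => - slope_form F (u - RtoC t * v) v d) 0 1) as [c [Hc Hc']]; [lra| |].
- intros t Ht; apply is_derive_Reals, is_derive_slope_field_line; auto; apply Hline; lra.
- rewrite E1, E0 in Hc.
  assert (H := Hform (u - RtoC c * v)%C v d (proj1 (Hline c ltac:(lra)))).
  lra.
Qed.

(** * The functional on a small circle *)

(** The conjugate of [e^(i theta)]. *)
Definition circle_conj (theta : R) : C := (cos theta, - sin theta).

(** The function [J] in terms of the boundary values [u] of the field; [c] multiplies
    the conjugate of [r e^(i theta)]. *)
Definition energy (F : R -> R) (u : R -> C) (r : R) (c : C) : R :=
  RInt (fun theta => F (Cmod (u theta - c * (RtoC r * circle_conj theta))) * r)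
    0 (2 * PI).

Lemma J_eq_energy (F : R -> R) (g : C -> C) (r : R) (z c : C) :
  J F g r z c = energy F (fun theta => young_field F (g (circle_point z r theta))) r c.
Proof.
unfold J, energy, circle_integral; apply RInt_ext; intros theta _.
do 3 f_equal; unfold circle_point.
replace (Cconj _) with (RtoC r * circle_conj theta)%C; [reflexivity|].
unfold Cconj; apply injective_projections; simpl; ring.
Qed.

Lemma energy_integrand_continuous (F : R -> R) (u : R -> C) (r : R) (c : C) :
  convex_profile F -> (forall theta, continuous (U := C_UniformSpace) u theta) ->
  forall theta, continuous (fun theta =>
    F (Cmod (u theta - c * (RtoC r * circle_conj theta))) * r) theta.
Proof.
intros HF Hu theta.
apply (continuous_mult (K := R_AbsRing)); [|apply continuous_const].
apply (continuous_ext (fun t =>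
  F (Rabs (Cmod (u t - c * (RtoC r * circle_conj t)))))).
{ intros t; now rewrite Rabs_pos_eq by apply Cmod_ge_0. }
apply (continuous_comp (fun t => Cmod (u t - c * (RtoC r * circle_conj t)))
  (fun x => F (Rabs x))); [|now apply profile_continuous_abs].
apply continuous_Cmod_comp.
assert (H1 := continuous_Cfst u theta (Hu theta)).
assert (H2 := continuous_Csnd u theta (Hu theta)).
assert (Htrig : forall p : R -> R, (forall t, ex_derive p t) -> continuous p theta).
{ intros p Hp; apply (@ex_derive_continuous R_AbsRing R_NormedModule), Hp. }
apply (continuous_ext (U := C_UniformSpace) (fun t =>
  (fst (u t) - (fst c * (r * cos t) + snd c * (r * sin t)),
   snd (u t) - (snd c * (r * cos t) - fst c * (r * sin t))) : C)).
- intros t; apply injective_projections; simpl; ring.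
- apply continuous_Cpair; apply (continuous_minus (V := R_NormedModule)); auto;
    apply Htrig; intros t; auto_derive; auto.
Qed.

Lemma ex_RInt_energy (F : R -> R) (u : R -> C) (r : R) (c : C) :
  convex_profile F -> (forall theta, continuous (U := C_UniformSpace) u theta) ->
  ex_RInt (fun theta =>
    F (Cmod (u theta - c * (RtoC r * circle_conj theta))) * r) 0 (2 * PI).
Proof.
intros HF Hu; apply (ex_RInt_continuous (V := R_CompleteNormedModule)).
intros t _; now apply energy_integrand_continuous.
Qed.

Lemma is_RInt_trig2 (a b p q s : R) :
  is_RInt (fun t => a * cos t + b * sin t + p * (cos t * cos t) + q * (cos t * sin t) +
    s * (sin t * sin t)) 0 (2 * PI) (PI * (p + s)).
Proof.
set (f := fun t => a * sin t - b * cos t + p * ((t + sin t * cos t) / 2) +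
  q * (sin t * sin t / 2) + s * ((t - sin t * cos t) / 2)).
replace (PI * (p + s)) with (minus (f (2 * PI)) (f 0)).
- apply (is_RInt_derive (V := R_CompleteNormedModule) f).
  + intros t _; unfold f; auto_derive; auto.
    assert (H := sin2_cos2 t); unfold Rsqr in H.
    replace (p * (cos t * cos t)) with (p * ((1 + cos t * cos t - sin t * sin t) / 2))
      by (rewrite <- H; field).
    replace (s * (sin t * sin t)) with (s * ((1 - cos t * cos t + sin t * sin t) / 2))
      by (rewrite <- H; field).
    field.
  + intros t _; apply (@ex_derive_continuous R_AbsRing R_NormedModule).
    auto_derive; auto.
- unfold f, minus, plus, opp; simpl; rewrite sin_2PI, cos_2PI, sin_0, cos_0; field.
Qed.

(** Half the trace of the Hessian form at [w]. *)
Definition half_trace (F : R -> R) (w : C) : R :=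
  slope_ratio F (Cmod w) + slope_defect F (Cmod w) * (Cmod w * Cmod w) / 2.

Lemma half_trace_pos (F : R -> R) : convex_profile F ->
  forall w, w <> RtoC 0 -> 0 < half_trace F w.
Proof.
intros HF w Hw; assert (Hp := proj1 (Cmod_gt_0 w) Hw).
assert (H1 := profile_pos F HF _ Hp); assert (H2 := profile_pos2 F HF _ Hp).
assert (H3 : 0 < slope_ratio F (Cmod w)) by now apply Rdiv_lt_0_compat.
replace (half_trace F w)
  with ((slope_ratio F (Cmod w) + Derive (Derive F) (Cmod w)) / 2); [lra|].
unfold half_trace, slope_defect; field; lra.
Qed.

(** The derivative of the real-linear map [(x, y) |-> x a + y b] with respect to the
    conjugate variable. *)
Definition dbar (a b : C) : C := ((fst a - snd b) / 2, (snd a + fst b) / 2).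

(** Averaging over the circle keeps only the rotation-invariant parts: the
    conjugate derivative of the linear map and half the trace of the Hessian form. *)
Lemma is_RInt_linearization (F : R -> R) (w0 g0 a b c e : C) (r : R) :
  is_RInt (fun t =>
      dot (g0 + RtoC r * (RtoC (cos t) * a + RtoC (sin t) * b)) (e * circle_conj t)
      - slope_form F w0 (c * (RtoC r * circle_conj t)) (e * circle_conj t))
    0 (2 * PI) (2 * PI * r * (dot (dbar a b) e - half_trace F w0 * dot c e)).
Proof.
destruct g0 as [g1 g2]; destruct a as [a1 a2]; destruct b as [b1 b2].
destruct c as [c1 c2]; destruct e as [e1 e2].
set (m11 := slope_ratio F (Cmod w0) + slope_defect F (Cmod w0) * (fst w0 * fst w0)).
set (m12 := slope_defect F (Cmod w0) * (fst w0 * snd w0)).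
set (m22 := slope_ratio F (Cmod w0) + slope_defect F (Cmod w0) * (snd w0 * snd w0)).
assert (Ht : half_trace F w0 = (m11 + m22) / 2).
{ unfold half_trace; rewrite Cmod_sqr; unfold dot, m11, m22; field. }
rewrite Ht.
set (p := r * (a1 * e1 + a2 * e2)
  - r * (m11 * (c1 * e1) + m12 * (c1 * e2 + c2 * e1) + m22 * (c2 * e2))).
set (s := r * (b1 * e2 - b2 * e1)
  - r * (m11 * (c2 * e2) - m12 * (c1 * e2 + c2 * e1) + m22 * (c1 * e1))).
set (q := r * (a1 * e2 + b1 * e1 - a2 * e1 + b2 * e2)
  - r * (m11 * (c1 * e2 + c2 * e1) + m12 * (2 * (c2 * e2 - c1 * e1))
         - m22 * (c1 * e2 + c2 * e1))).
match goal with |- is_RInt _ _ _ ?l => replace l with (PI * (p + s)) end.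
- apply (is_RInt_ext (fun t => (g1 * e1 + g2 * e2) * cos t + (g1 * e2 - g2 * e1) * sin t
    + p * (cos t * cos t) + q * (cos t * sin t) + s * (sin t * sin t)));
    [|apply is_RInt_trig2].
  intros t _; rewrite slope_form_entries; fold m11 m12 m22.
  unfold dot, p, q, s; simpl; ring.
- unfold p, s, dbar, dot; simpl; field.
Qed.

Lemma Cmod_conj_unit (t : R) : Cmod (circle_conj t) = 1.
Proof.
assert (H := Cmod_sqr (circle_conj t)); unfold dot in H; simpl in H.
assert (H2 := sin2_cos2 t); unfold Rsqr in H2.
assert (H3 := Cmod_ge_0 (circle_conj t)); nra.
Qed.

(** If [u] is close to [w0] and [A(u)] agrees with an affine map up to [eps r] on the
    circle of radius [r], then any [c] outside the disk of radius [delta] about [cs] is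
    beaten by a point of that disk. *)
Lemma energy_gap (F : R -> R) : convex_profile F ->
  forall w0 : C, w0 <> RtoC 0 -> forall (g0 a b cs : C),
  (RtoC (half_trace F w0) * cs)%C = dbar a b ->
  forall delta, 0 < delta -> exists eta eps, 0 < eta /\ 0 < eps /\
  forall (r : R) (u : R -> C), 0 < r < eta ->
  (forall t, continuous (U := C_UniformSpace) u t) ->
  (forall t, Cmod (u t - w0) < eta) ->
  (forall t, Cmod (slope_field F (u t)
     - (g0 + RtoC r * (RtoC (cos t) * a + RtoC (sin t) * b))) <= eps * r) ->
  forall c, delta < Cmod (c - cs) ->
  exists c', Cmod (c' - cs) <= delta /\ energy F u r c' < energy F u r c.
Proof.
intros HF w0 Hw0 g0 a b cs Hcs delta Hdelta.
assert (Hk := half_trace_pos F HF w0 Hw0); set (k := half_trace F w0) in *.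
set (M := Cmod cs + delta).
assert (HM : 0 < M) by (assert (H := Cmod_ge_0 cs); unfold M; lra).
assert (Hkd : 0 < k * delta) by now apply Rmult_lt_0_compat.
(* Each of the two errors, linearization of [A] and of the boundary data, is allowed
   [k delta r / 4], against a main term [- k delta r]; [M] bounds [|c'|]. *)
assert (Heps1 : 0 < k * delta / 4 / M) by (apply Rdiv_lt_0_compat; lra).
destruct (slope_field_strict_derive F HF w0 Hw0 _ Heps1) as [eta [Heta Hstrict]].
exists (Rmin eta (eta / M)), (k * delta / 4).
split; [apply Rmin_glb_lt; auto; now apply Rdiv_lt_0_compat|].
split; [lra|].
intros r u [Hr Hr'] Cu Hu Hlin c Hc.
assert (Hr1 := Rlt_le_trans _ _ _ Hr' (Rmin_r _ _)).
set (rho := Cmod (c - cs)) in *.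
assert (Hrho : 0 < rho) by lra.
set (e := (RtoC (/ rho) * (c - cs))%C).
assert (He : Cmod e = 1).
{ unfold e; rewrite Cmod_mult, Cmod_R, Rabs_pos_eq.
  - fold rho; field; lra.
  - apply Rlt_le, Rinv_0_lt_compat; auto. }
set (c' := (cs + RtoC delta * e)%C).
assert (Hc' : Cmod (c' - cs) = delta).
{ unfold c'; replace (cs + RtoC delta * e - cs)%C with (RtoC delta * e)%C by ring.
  rewrite Cmod_mult, He, Cmod_R, Rabs_pos_eq; lra. }
assert (Hcc : (c' - c)%C = (RtoC (- (rho - delta)) * e)%C).
{ assert (Hce : (c - cs)%C = (RtoC rho * e)%C).
  { unfold e; rewrite Cmult_assoc, <- RtoC_mult, Rinv_r by lra; ring. }
  unfold c'; replace (cs + RtoC delta * e - c)%C with (RtoC delta * e - (c - cs))%C by ring.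
  rewrite Hce, RtoC_opp, RtoC_minus; ring. }
exists c'; split; [lra|].
(* [T] is the linearization of the pairing of [A (u - c' r ebar)] with [e ebar]. *)
set (T := fun t =>
  dot (g0 + RtoC r * (RtoC (cos t) * a + RtoC (sin t) * b)) (e * circle_conj t)
  - slope_form F w0 (c' * (RtoC r * circle_conj t)) (e * circle_conj t)).
assert (Hpt : forall t,
  F (Cmod (u t - c' * (RtoC r * circle_conj t))) * r
    - (rho - delta) * r * r * (T t + k * delta / 2 * r)
  <= F (Cmod (u t - c * (RtoC r * circle_conj t))) * r).
{ intros t; set (x := circle_conj t).
  set (v := (c' * (RtoC r * x))%C); set (d := (e * x)%C).
  assert (Hx : Cmod x = 1) by apply Cmod_conj_unit.
  assert (Hd : Cmod d = 1) by (unfold d; rewrite Cmod_mult, He, Hx; ring).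
  assert (Hv : Cmod v <= M * r).
  { unfold v; rewrite !Cmod_mult, Hx, Cmod_R, Rabs_pos_eq, Rmult_1_r by lra.
    apply Rmult_le_compat_r; [lra|].
    replace c' with (cs + (c' - cs))%C by ring.
    eapply Rle_trans; [apply Cmod_triangle|]; unfold M; lra. }
  assert (Hv' : Cmod v < eta).
  { apply Rle_lt_trans with (M * r); auto.
    replace eta with (M * (eta / M)) by (field; lra).
    now apply Rmult_lt_compat_l. }
  destruct (Hstrict (u t) v d) as [Hne Hs]; auto.
  { eapply Rlt_le_trans; [apply Hu|apply Rmin_l]. }
  assert (Hgrad := slope_field_gradient F HF (u t - v)
    (u t - c * (RtoC r * x)) Hne).
  replace (u t - c * (RtoC r * x) - (u t - v))%C
    with (RtoC (- (rho - delta) * r) * d)%C in Hgrad.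
  2:{ replace (u t - c * (RtoC r * x) - (u t - v))%C with ((c' - c) * (RtoC r * x))%C
        by (unfold v; ring).
      rewrite Hcc, RtoC_mult; unfold d; ring. }
  assert (Hsym : forall y, dot y (RtoC (- (rho - delta) * r) * d) =
    - ((rho - delta) * r) * dot y d) by (intros y; unfold dot; simpl; ring).
  rewrite Hsym in Hgrad.
  assert (Hl := dot_le_Cmod (slope_field F (u t)
     - (g0 + RtoC r * (RtoC (cos t) * a + RtoC (sin t) * b))) d).
  rewrite Hd, Rmult_1_r in Hl.
  specialize (Hlin t).
  assert (Hsub : forall y y' : C, dot (y - y') d = dot y d - dot y' d)
    by (intros; unfold dot; simpl; ring).
  rewrite Hsub in Hl.
  assert (HT : dot (slope_field F (u t - v)) d <= T t + k * delta / 2 * r).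
  { assert (k * delta / 4 / M * (Cmod v * Cmod d) <= k * delta / 4 * r).
    { rewrite Hd, Rmult_1_r.
      replace (k * delta / 4 * r) with (k * delta / 4 / M * (M * r)) by (field; lra).
      apply Rmult_le_compat_l; lra. }
    unfold T; fold x v d; lra. }
  assert (Hpos : 0 <= (rho - delta) * r) by (apply Rmult_le_pos; lra).
  assert (Hm := Rmult_le_compat_l _ _ _ Hpos HT).
  assert (Hfin : F (Cmod (u t - v)) - (rho - delta) * r * (T t + k * delta / 2 * r)
    <= F (Cmod (u t - c * (RtoC r * x)))) by lra.
  apply (Rmult_le_compat_r r) in Hfin; [|lra].
  eapply Rle_trans; [|exact Hfin]; right; ring. }
assert (IT : is_RInt T 0 (2 * PI) (2 * PI * r * (dot (dbar a b) e - k * dot c' e)))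
  by apply is_RInt_linearization.
assert (Hval : 2 * PI * r * (dot (dbar a b) e - k * dot c' e) = - (2 * PI * r * (k * delta))).
{ assert (dot c' e = dot cs e + delta).
  { replace (dot c' e) with (dot cs e + delta * dot e e) by (unfold c', dot; simpl; ring).
    rewrite <- Cmod_sqr, He; ring. }
  rewrite <- Hcs, dot_scal_l, H; ring. }
rewrite Hval in IT.
assert (Ic' := RInt_correct _ _ _ (ex_RInt_energy F u r c' HF Cu)).
assert (Ic := RInt_correct _ _ _ (ex_RInt_energy F u r c HF Cu)).
assert (IK := is_RInt_const 0 (2 * PI) (k * delta / 2 * r)).
assert (IS := is_RInt_scal _ _ _ ((rho - delta) * r * r) _ (is_RInt_plus _ _ _ _ _ _ IT IK)).
assert (IM := is_RInt_minus _ _ _ _ _ _ Ic' IS).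
assert (HPI := PI_RGT_0); assert (H2PI : 0 <= 2 * PI) by lra.
assert (Hle := is_RInt_le _ _ _ _ _ _ H2PI IM Ic (fun t _ => Hpt t)).
change (energy F u r c' - (rho - delta) * r * r *
  (- (2 * PI * r * (k * delta)) + (2 * PI - 0) * (k * delta / 2 * r)) <= energy F u r c) in Hle.
assert (0 < (rho - delta) * r * r * (PI * r * (k * delta)))
  by (apply Rmult_lt_0_compat; repeat (apply Rmult_lt_0_compat; [|lra || assumption]); lra).
lra.
Qed.

(** * Existence of minimum points *)

Lemma profile_lipschitz (F : R -> R) : convex_profile F ->
  forall B t t', 0 < B -> 0 <= t <= B -> 0 <= t' <= B ->
  F t - F t' <= Derive F B * Rabs (t - t').
Proof.
intros HF B t t' HB Ht Ht'.
assert (HfB := profile_pos F HF B HB).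
destruct (Rlt_le_dec 0 t) as [Hp|Hp].
- assert (Htan := profile_tangent F HF t t' Hp ltac:(lra)).
  assert (Hft := profile_pos F HF t Hp).
  assert (Hle : Derive F t <= Derive F B).
  { destruct (Rle_lt_or_eq_dec t B) as [H|H]; [lra| |subst; lra].
    apply Rlt_le, profile_increasing; auto; lra. }
  destruct (Rle_lt_dec t' t) as [H|H].
  + rewrite Rabs_pos_eq by lra; nra.
  + rewrite Rabs_left by lra; nra.
- replace t with 0 by lra.
  assert (Hmin := profile_min F HF t' ltac:(lra)).
  assert (Habs := Rabs_pos (0 - t')); nra.
Qed.

Lemma energy_locally_lipschitz (F : R -> R) (u : R -> C) (r U : R) :
  convex_profile F -> (forall t, continuous (U := C_UniformSpace) u t) ->
  (forall t, Cmod (u t) <= U) -> 0 < r ->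
  forall M, 0 <= M -> exists K, 0 <= K /\
  forall c1 c2 : C, Cmod c1 <= M -> Cmod c2 <= M ->
    energy F u r c1 <= energy F u r c2 + K * Cmod (c1 - c2).
Proof.
intros HF Cu HU Hr M HM.
assert (HU0 : 0 <= U) by (eapply Rle_trans; [apply Cmod_ge_0|apply (HU 0)]).
set (B := U + M * r + 1).
assert (HB : 0 < B) by (assert (0 <= M * r) by (apply Rmult_le_pos; lra); unfold B; lra).
assert (HfB := profile_pos F HF B HB).
assert (HPI := PI_RGT_0); assert (H2PI : 0 <= 2 * PI) by lra.
exists (2 * PI * (Derive F B * r * r)); split.
{ apply Rmult_le_pos; auto; repeat apply Rmult_le_pos; lra. }
intros c1 c2 H1 H2.
assert (I1 := RInt_correct _ _ _ (ex_RInt_energy F u r c1 HF Cu)).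
assert (I2 := RInt_correct _ _ _ (ex_RInt_energy F u r c2 HF Cu)).
assert (IK := is_RInt_const 0 (2 * PI) (Derive F B * r * r * Cmod (c1 - c2))).
assert (IP := is_RInt_plus _ _ _ _ _ _ I2 IK).
assert (Hnorm : forall c t, Cmod (c * (RtoC r * circle_conj t)) = Cmod c * r).
{ intros c t; rewrite !Cmod_mult, Cmod_conj_unit, Cmod_R, Rabs_pos_eq; lra. }
assert (Hbound : forall c t, Cmod c <= M ->
  0 <= Cmod (u t - c * (RtoC r * circle_conj t)) <= B).
{ intros c t Hc; split; [apply Cmod_ge_0|].
  eapply Rle_trans; [apply Cmod_triangle|]; rewrite Cmod_opp, Hnorm.
  specialize (HU t); assert (Cmod c * r <= M * r) by (apply Rmult_le_compat_r; lra).
  unfold B; lra. }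
assert (Hpt : forall t, 0 < t < 2 * PI ->
  F (Cmod (u t - c1 * (RtoC r * circle_conj t))) * r <=
  F (Cmod (u t - c2 * (RtoC r * circle_conj t))) * r
    + Derive F B * r * r * Cmod (c1 - c2)).
{ intros t _.
  set (w1 := (u t - c1 * (RtoC r * circle_conj t))%C).
  set (w2 := (u t - c2 * (RtoC r * circle_conj t))%C).
  assert (HL := profile_lipschitz F HF B (Cmod w1) (Cmod w2) HB
    (Hbound c1 t H1) (Hbound c2 t H2)).
  assert (Hd : Rabs (Cmod w1 - Cmod w2) <= Cmod (c1 - c2) * r).
  { assert (T1 : Cmod (w1 - w2) = Cmod (c1 - c2) * r).
    { rewrite <- (Hnorm (c1 - c2)%C t), <- Cmod_opp; f_equal; unfold w1, w2; ring. }
    assert (T2 := Cmod_triangle (w1 - w2) w2); assert (T3 := Cmod_triangle (w2 - w1) w1).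
    replace (w1 - w2 + w2)%C with w1 in T2 by ring.
    replace (w2 - w1 + w1)%C with w2 in T3 by ring.
    replace (w2 - w1)%C with (- (w1 - w2))%C in T3 by ring; rewrite Cmod_opp in T3.
    apply Rabs_le; lra. }
  assert (HL' : F (Cmod w1) - F (Cmod w2) <= Derive F B * (Cmod (c1 - c2) * r)).
  { eapply Rle_trans; [exact HL|]; apply Rmult_le_compat_l; lra. }
  apply (Rmult_le_compat_r r) in HL'; lra. }
assert (Hle := is_RInt_le _ _ _ _ _ _ H2PI I1 IP Hpt).
change (energy F u r c1 <= energy F u r c2 +
  (2 * PI - 0) * (Derive F B * r * r * Cmod (c1 - c2))) in Hle.
lra.
Qed.

Lemma continuity_pt_of_lipschitz (f : R -> R) (x K : R) : 0 <= K ->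
  (forall y, Rabs (y - x) < 1 ->
    f y <= f x + K * Rabs (y - x) /\ f x <= f y + K * Rabs (y - x)) ->
  continuity_pt f x.
Proof.
intros HK Hf; apply continuity_pt_filterlim, filterlim_locally; intros [eps Heps].
assert (Hq : 0 < eps / (K + 1)) by (apply Rdiv_lt_0_compat; lra).
assert (Hd : 0 < Rmin 1 (eps / (K + 1))) by (apply Rmin_glb_lt; lra).
exists (mkposreal _ Hd); intros y Hy.
change (Rabs (y - x) < Rmin 1 (eps / (K + 1))) in Hy.
assert (Hy1 := Rlt_le_trans _ _ _ Hy (Rmin_l _ _)).
assert (Hy2 := Rlt_le_trans _ _ _ Hy (Rmin_r _ _)).
specialize (Hf y Hy1); change (Rabs (f y - f x) < eps).
assert (Habs := Rabs_pos (y - x)).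
assert (Hlt : (K + 1) * Rabs (y - x) < eps).
{ replace eps with ((K + 1) * (eps / (K + 1))) by (field; lra).
  apply Rmult_lt_compat_l; lra. }
apply Rabs_def1; lra.
Qed.

(** A locally Lipschitz function attains its minimum on a rectangle: minimize in the
    second coordinate first; the partial minimum is again locally Lipschitz. *)
Lemma exists_min_rectangle (h : C -> R) (x0 x1 y0 y1 : R) : x0 <= x1 -> y0 <= y1 ->
  (forall M, 0 <= M -> exists K, 0 <= K /\
    forall c1 c2 : C, Cmod c1 <= M -> Cmod c2 <= M -> h c1 <= h c2 + K * Cmod (c1 - c2)) ->
  exists c, forall x y, x0 <= x <= x1 -> y0 <= y <= y1 -> h c <= h (x, y).
Proof.
intros Hx Hy Hlip.
assert (Cbox : forall x y, Cmod (x, y) <= Rabs x + Rabs y).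
{ intros x y; replace (x, y) with (RtoC x + RtoC y * Ci)%C
    by (apply injective_projections; simpl; ring).
  eapply Rle_trans; [apply Cmod_triangle|].
  rewrite Cmod_mult, !Cmod_R, Cmod_Ci; lra. }
set (N := Rabs y0 + Rabs y1).
assert (HN : 0 <= N) by (assert (A := Rabs_pos y0); assert (B := Rabs_pos y1); unfold N; lra).
assert (Hin : forall y, y0 <= y <= y1 -> Rabs y <= N).
{ intros y Hy'; assert (A := Rabs_pos y0); assert (B := Rabs_pos y1).
  assert (A' := Rabs_maj2 y0); assert (B' := Rle_abs y1).
  apply Rabs_le; unfold N; lra. }
assert (Hnear : forall s t, Rabs (t - s) < 1 -> Rabs t <= Rabs s + 1).
{ intros s t H; assert (T := Rabs_triang (t - s) s).
  replace (t - s + s) with t in T by ring; lra. }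
assert (HdX : forall s t y, Cmod ((s, y) - (t, y)) = Rabs (s - t)).
{ intros s t y; rewrite <- Cmod_R; f_equal.
  apply injective_projections; simpl; ring. }
assert (HdY : forall x s t, Cmod ((x, s) - (x, t)) = Rabs (s - t)).
{ intros x s t; replace ((x, s) - (x, t))%C with (RtoC (s - t) * Ci)%C
    by (apply injective_projections; simpl; ring).
  rewrite Cmod_mult, Cmod_R, Cmod_Ci; ring. }
assert (Hmin : forall x, exists m, (forall y, y0 <= y <= y1 -> h (x, m) <= h (x, y))
  /\ y0 <= m <= y1).
{ intros x; apply (continuity_ab_min (fun y => h (x, y))); auto.
  intros y _.
  assert (HM : 0 <= Rabs x + (Rabs y + 1))
    by (assert (A := Rabs_pos x); assert (B := Rabs_pos y); lra).
  destruct (Hlip _ HM) as [K [HK HL]].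
  apply continuity_pt_of_lipschitz with K; auto; intros y' Hy'.
  specialize (Hnear y y' Hy').
  assert (B1 := Cbox x y); assert (B2 := Cbox x y').
  split.
  - rewrite <- (HdY x); apply HL; lra.
  - rewrite Rabs_minus_sym, <- (HdY x); apply HL; lra. }
set (Y := fun x => proj1_sig (constructive_indefinite_description _ (Hmin x))).
assert (HY : forall x, (forall y, y0 <= y <= y1 -> h (x, Y x) <= h (x, y))
  /\ y0 <= Y x <= y1)
  by (intros x; apply (proj2_sig (constructive_indefinite_description _ (Hmin x)))).
destruct (continuity_ab_min (fun x => h (x, Y x)) x0 x1 Hx) as [m [Hm _]].
- intros x _.
  assert (HM : 0 <= Rabs x + 1 + N) by (assert (A := Rabs_pos x); lra).
  destruct (Hlip _ HM) as [K [HK HL]].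
  apply continuity_pt_of_lipschitz with K; auto; intros x' Hx'.
  specialize (Hnear x x' Hx').
  destruct (HY x) as [H1 H2]; destruct (HY x') as [H1' H2'].
  assert (B1 := Hin _ H2); assert (B2 := Hin _ H2').
  assert (C11 := Cbox x (Y x)); assert (C12 := Cbox x (Y x')).
  assert (C21 := Cbox x' (Y x)); assert (C22 := Cbox x' (Y x')).
  split.
  + eapply Rle_trans; [apply H1', H2|]; rewrite <- (HdX x' x (Y x)); apply HL; lra.
  + eapply Rle_trans; [apply H1, H2'|].
    rewrite Rabs_minus_sym, <- (HdX x x' (Y x')); apply HL; lra.
- exists (m, Y m); intros x y Hx' Hy'.
  eapply Rle_trans; [apply (Hm x Hx')|]; now apply HY.
Qed.

(** * Differentiability of plane maps *)

(** [g] is differentiable in the real sense at [z], with partial derivatives [a] and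
    [b]. *)
Definition has_partials (g : C -> C) (z a b : C) : Prop :=
  forall eps, 0 < eps -> exists d, 0 < d /\ forall y, Cmod (y - z) < d ->
    Cmod (g y - g z - (RtoC (fst (y - z)%C) * a + RtoC (snd (y - z)%C) * b))
      <= eps * Cmod (y - z).

Lemma real_differentiable_partials (g : C -> C) (z : C) :
  real_differentiable g z -> exists a b, has_partials g z a b.
Proof.
intros [l [[Lp Ls _] Hl]].
exists (l (RtoC 1)), (l Ci); intros eps Heps.
assert (H := Hl z (fun P HP => HP) (mkposreal eps Heps)).
destruct (locally_C_ex _ _ H) as [d [Hd Hy]]; clear H.
exists d; split; auto; intros y Hyd; specialize (Hy y Hyd).
rewrite <- !Cmod_norm in Hy; simpl in Hy.
change (Cmod (g y - g z - l (y - z)%C) <= eps * Cmod (y - z)) in Hy.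
replace (RtoC (fst (y - z)%C) * l (RtoC 1) + RtoC (snd (y - z)%C) * l Ci)%C
  with (l (y - z)%C); auto.
transitivity (l (plus (scal (fst (y - z)%C) (RtoC 1)) (scal (snd (y - z)%C) Ci))).
- f_equal; apply injective_projections; unfold plus, scal; simpl;
    unfold plus, scal, mult; simpl; unfold mult; simpl; ring.
- rewrite Lp, !Ls; apply injective_projections; unfold plus, scal; simpl;
    unfold plus, scal, mult; simpl; unfold mult; simpl; ring.
Qed.

Lemma real_differentiable_continuous (g : C -> C) (z : C) :
  real_differentiable g z ->
  continuous (T := C_UniformSpace) (U := C_UniformSpace) g z.
Proof. exact (filterdiff_continuous (U := C_R_NormedModule) (V := C_R_NormedModule) g z). Qed.

(** The Cauchy-Riemann equation. *)
Lemma ex_derive_C_iff_partials (g : C -> C) (z : C) :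
  ex_derive (K := C_AbsRing) (V := C_NormedModule) g z <->
  exists a, has_partials g z a (Ci * a).
Proof.
assert (Hlin : forall v a : C,
  (RtoC (fst v) * a + RtoC (snd v) * (Ci * a) = v * a)%C)
  by (intros v a; apply injective_projections; simpl; ring).
split.
- intros [a [_ Ha]]; exists a; intros eps Heps.
  destruct (Ha z (fun P HP => HP) (mkposreal eps Heps)) as [d Hd].
  exists d; split; [apply cond_pos|]; intros y Hy.
  rewrite Hlin; exact (Hd y Hy).
- intros [a Ha]; exists a; split; [apply is_linear_scal_l|].
  intros x Hx.
  apply (is_filter_lim_locally_unique (V := AbsRing_NormedModule C_AbsRing)) in Hx; subst x.
  intros [eps Heps]; destruct (Ha eps Heps) as [d [Hd Hy]].
  exists (mkposreal d Hd); intros y Hyd.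
  specialize (Hy y Hyd); rewrite Hlin in Hy; exact Hy.
Qed.

Lemma dbar_eq_0 (a b : C) : dbar a b = RtoC 0 <-> b = (Ci * a)%C.
Proof.
unfold dbar; destruct a as [a1 a2]; destruct b as [b1 b2]; simpl; split; intros H.
- injection H as H1 H2; apply injective_projections; simpl; lra.
- injection H as -> ->; apply injective_projections; simpl; field.
Qed.

(** * Limit of the minimum points *)

Lemma circle_point_continuous (z : C) (r t : R) :
  continuous (U := C_UniformSpace) (circle_point z r) t.
Proof.
apply (continuous_ext (U := C_UniformSpace)
  (fun t => (fst z + r * cos t, snd z + r * sin t) : C)).
- intros s; apply injective_projections; simpl; ring.
- apply continuous_Cpair; apply (@ex_derive_continuous R_AbsRing R_NormedModule);
    auto_derive; auto.
Qed.

Lemma circle_point_dist (z : C) (r t : R) : 0 < r -> Cmod (circle_point z r t - z) = r.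
Proof.
intros Hr; unfold circle_point.
replace (z + RtoC r * (cos t, sin t) - z)%C with (RtoC r * (cos t, sin t))%C by ring.
replace (cos t, sin t) with (Cconj (circle_conj t))
  by (unfold Cconj, circle_conj; simpl; now rewrite Ropp_involutive).
rewrite Cmod_mult, Cmod_conj, Cmod_conj_unit, Cmod_R, Rabs_pos_eq; lra.
Qed.

(** As [r] tends to 0, the minimum points tend to the conjugate derivative of [g] at [z]
    divided by half the trace of [DA] at [V (g z)]. *)
Lemma cJ_limit (F : R -> R) (Omega : C -> Prop) (g : C -> C) (z a b cs : C) :
  convex_profile F -> open (T := C_UniformSpace) Omega ->
  (forall y, Omega y -> continuous (T := C_UniformSpace) (U := C_UniformSpace) g y) ->
  Omega z -> g z <> RtoC 0 -> has_partials g z a b ->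
  (RtoC (half_trace F (young_field F (g z))) * cs)%C = dbar a b ->
  filterlim (fun r => cJ F g r z) (at_right 0) (locally (T := C_UniformSpace) cs).
Proof.
intros HF HO Cg Hz Hgz Hab Hcs P HP.
destruct (locally_C_ex _ _ HP) as [delta [Hdelta HPd]].
set (w0 := young_field F (g z)) in *.
assert (Hw0 : w0 <> RtoC 0) by now apply young_field_neq_0.
assert (Hd2 : 0 < delta / 2) by lra.
destruct (energy_gap F HF w0 Hw0 (g z) a b cs Hcs _ Hd2) as [eta [eps [Heta [Heps Hgap]]]].
destruct (Hab eps Heps) as [d1 [Hd1 Hlin]].
destruct (continuous_C_ex (fun y => young_field F (g y)) z) with (eps := eta)
  as [d2 [Hd2' Hnear]]; auto.
{ apply (continuous_comp (U := C_UniformSpace) (V := C_UniformSpace)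
    (W := C_UniformSpace) g (young_field F)); auto.
  now apply young_field_continuous. }
destruct (continuous_C_ex g z (Cg z Hz) (Cmod (g z))) as [d3 [Hd3 Hne]].
{ now apply Cmod_gt_0. }
destruct (locally_C_ex z Omega (HO z Hz)) as [d4 [Hd4 Hin]].
assert (Hr0 : 0 < Rmin eta (Rmin (Rmin d1 d2) (Rmin d3 d4)))
  by (repeat apply Rmin_glb_lt; auto).
exists (mkposreal _ Hr0); intros r Hball Hr; apply HPd.
change (Rabs (r - 0) < Rmin eta (Rmin (Rmin d1 d2) (Rmin d3 d4))) in Hball.
rewrite Rminus_0_r, Rabs_pos_eq in Hball by lra.
assert (Hr1 : r < eta) by (eapply Rlt_le_trans; [exact Hball|apply Rmin_l]).
assert (Hb := Rlt_le_trans _ _ _ Hball (Rmin_r _ _)); clear Hball.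
assert (Hb1 := Rlt_le_trans _ _ _ Hb (Rmin_l _ _)).
assert (Hb2 := Rlt_le_trans _ _ _ Hb (Rmin_r _ _)); clear Hb.
assert (Hr2 := Rlt_le_trans _ _ _ Hb1 (Rmin_l _ _)).
assert (Hr3 := Rlt_le_trans _ _ _ Hb1 (Rmin_r _ _)); clear Hb1.
assert (Hr4 := Rlt_le_trans _ _ _ Hb2 (Rmin_l _ _)).
assert (Hr5 := Rlt_le_trans _ _ _ Hb2 (Rmin_r _ _)); clear Hb2.
set (y := circle_point z r).
assert (Hy : forall t, Cmod (y t - z) = r) by (intros t; now apply circle_point_dist).
set (u := fun t => young_field F (g (y t))).
assert (Hgy : forall t, g (y t) <> RtoC 0).
{ intros t H; assert (Hlt := Hne (y t) ltac:(rewrite Hy; lra)).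
  rewrite H in Hlt; replace (0 - g z)%C with (- g z)%C in Hlt by ring.
  rewrite Cmod_opp in Hlt; lra. }
assert (Cu : forall t, continuous (U := C_UniformSpace) u t).
{ intros t; apply (continuous_comp (V := C_UniformSpace) (W := C_UniformSpace)
    (fun t => g (y t)) (young_field F)); [|now apply young_field_continuous].
  apply (continuous_comp (V := C_UniformSpace) (W := C_UniformSpace) y g).
  - apply circle_point_continuous.
  - apply Cg, Hin; rewrite Hy; lra. }
assert (Hu : forall t, Cmod (u t - w0) < eta) by (intros t; apply Hnear; rewrite Hy; lra).
assert (HA : forall t, Cmod (slope_field F (u t)
     - (g z + RtoC r * (RtoC (cos t) * a + RtoC (sin t) * b))) <= eps * r).
{ intros t; unfold u; rewrite slope_field_young_field by auto.
  assert (H := Hlin (y t) ltac:(rewrite Hy; lra)); rewrite Hy in H.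
  eapply Rle_trans; [right|exact H]; f_equal.
  unfold y, circle_point; apply injective_projections; simpl; ring. }
specialize (Hgap r u (conj Hr Hr1) Cu Hu HA).
assert (HJ : forall c, J F g r z c = energy F u r c) by (intros c; apply J_eq_energy).
assert (Hex : exists c, is_min_point (J F g r z) c).
{ destruct (exists_min_rectangle (energy F u r)
    (fst cs - delta / 2) (fst cs + delta / 2) (snd cs - delta / 2) (snd cs + delta / 2))
    as [c Hc]; [lra|lra| |].
  - apply energy_locally_lipschitz with (Cmod w0 + eta); auto.
    intros t; replace (u t) with (w0 + (u t - w0))%C by ring.
    eapply Rle_trans; [apply Cmod_triangle|]; specialize (Hu t); lra.
  - assert (Hdisk : forall c', Cmod (c' - cs) <= delta / 2 ->
      energy F u r c <= energy F u r c').
    { intros c' Hc'; rewrite (surjective_pairing c').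
      assert (B1 := Rabs_fst_Cmod (c' - cs)); assert (B2 := Rabs_snd_Cmod (c' - cs)).
      simpl in B1, B2.
      apply Hc.
      - assert (B := Rle_trans _ _ _ B1 Hc'); apply Rabs_le_between in B; lra.
      - assert (B := Rle_trans _ _ _ B2 Hc'); apply Rabs_le_between in B; lra. }
    exists c; intros c'; rewrite !HJ.
    destruct (Rle_lt_dec (Cmod (c' - cs)) (delta / 2)) as [H|H]; auto.
    destruct (Hgap c' H) as [c'' [H1 H2]]; specialize (Hdisk c'' H1); lra. }
assert (Hmin := epsilon_spec (inhabits (RtoC 0)) _ Hex).
change (is_min_point (J F g r z) (cJ F g r z)) in Hmin.
destruct (Rlt_le_dec (delta / 2) (Cmod (cJ F g r z - cs))) as [H|H]; [|lra].
destruct (Hgap _ H) as [c' [_ Hlt]].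
specialize (Hmin c'); rewrite !HJ in Hmin; lra.
Qed.

Theorem theorem1p3 (F : R -> R) (Lm Lp : R) (Omega : C -> Prop) (g : C -> C)
  (F_nonneg : forall s, 0 <= s -> 0 <= F s)
  (F_C1 : C1_nonneg F)
  (F_C2 : C2_pos F)
  (F_convex : strictly_convex_nonneg F)
  (F_0 : F 0 = 0)
  (F'_0 : is_right_derive F 0 0)
  (Lm_pos : 0 < Lm)
  (Lm_le_Lp : Lm <= Lp)
  (Lambda_bounds : forall s, 0 < s -> Lm <= Lambda F s <= Lp)
  (Omega_open : open (T := C_UniformSpace) Omega)
  (g_diff : forall z, Omega z -> real_differentiable g z) :
  holomorphic_on (fun z => Omega z /\ g z <> RtoC 0) g <->
  (forall z, Omega z -> g z <> RtoC 0 ->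
     filterlim (fun r => cJ F g r z) (at_right 0)
       (locally (T := C_UniformSpace) (RtoC 0))).
Proof.
assert (HF : convex_profile F).
{ apply convex_profile_of_Lambda_bound with Lm; auto.
  intros s Hs; apply Lambda_bounds; auto. }
assert (Cg : forall y, Omega y ->
  continuous (T := C_UniformSpace) (U := C_UniformSpace) g y)
  by (intros y Hy; now apply real_differentiable_continuous, g_diff).
split.
- intros Hhol z Hz Hgz.
  destruct (proj1 (ex_derive_C_iff_partials g z) (Hhol z (conj Hz Hgz))) as [a Ha].
  apply (cJ_limit F Omega g z a (Ci * a)%C); auto.
  rewrite (proj2 (dbar_eq_0 a (Ci * a)%C)); auto; ring.
- intros Hlim z [Hz Hgz]; apply ex_derive_C_iff_partials.
  destruct (real_differentiable_partials g z (g_diff z Hz)) as [a [b Hab]].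
  exists a; replace (Ci * a)%C with b; auto; apply dbar_eq_0.
  set (k := half_trace F (young_field F (g z))).
  assert (Hk : 0 < k) by (apply half_trace_pos; auto; now apply young_field_neq_0).
  assert (Hcs : (RtoC k * (RtoC (/ k) * dbar a b))%C = dbar a b).
  { rewrite Cmult_assoc, <- RtoC_mult, Rinv_r by lra; ring. }
  assert (L := cJ_limit F Omega g z a b _ HF Omega_open Cg Hz Hgz Hab Hcs).
  assert (E := filterlim_locally_unique (V := C_R_NormedModule) _ _ _ L (Hlim z Hz Hgz)).
  rewrite <- Hcs, E; ring.
Qed.
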